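(* Let $(\mathcal{M}, d_{\mathrm{GH}})$ be the Gromov-Hausdorff space. Let $X,Y$ be bounded metric spaces each of which can be isometrically embedded into $(\mathcal{M}, d_{\mathrm{GH}})$. Then the product space $X\times Y$ equipped with the $\ell^\infty$ distance can be isometrically embedded into $(\mathcal{M}, d_{\mathrm{GH}})$.
   Context: The Gromov-Hausdorff space is the metric space $(\mathcal{M},d_{\mathrm{GH}})$, where $\mathcal{M}$ is a set of representatives of the isometry classes of nonempty compact metric spaces: every element of $\mathcal{M}$ is a nonempty compact metric space, every nonempty compact metric space is isometric to some element of $\mathcal{M}$, and two isometric elements of $\mathcal{M}$ are equal. For sets $A,B$, let $\mathrm{GHC}(A,B)$ be the collection of all subsets $R\subset A\times B$ such that every $a\in A$ satisfies $(a,b)\in R$ for some $b\in B$ and every $b\in B$ satisfies $(a,b)\in R$ for some $a\in A$. For metric spaces $(A,d_A),(B,d_B)$ and $R\in\mathrm{GHC}(A,B)$, the distortion is $\operatorname{dis}(R)=\sup\{|d_A(a,\alpha)-d_B(b,\beta)| \mid (a,b),(\alpha,\beta)\in R\}$. The Gromov-Hausdorff distance is $d_{\mathrm{GH}}(A,B)=\frac12\inf_{R\in\mathrm{GHC}(A,B)}\operatorname{dis}(R)$. The $\ell^\infty$ distance on a product of two metric spaces is the maximum of the two coordinatewise distances. An isometric embedding is a distance-preserving map (not necessarily surjective). *)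

(* Defs.v *)
From HB Require Import structures.
From mathcomp Require Import all_boot all_order all_algebra.
From mathcomp Require Import boolp classical_sets reals ereal topology.

Set Implicit Arguments.
Unset Strict Implicit.
Unset Printing Implicit Defensive.

Import Order.TTheory GRing.Theory Num.Theory.

Local Open Scope classical_set_scope.
Local Open Scope ring_scope.

(* The library's product pseudometric has the products of balls as its balls,
   i.e. it is the l^oo one; this instance records the distance itself. *)
Section prod_metric.
Context {R : realType} {X Y : metricType R}.

Let dist (p q : X * Y) : R := Num.max (mdist p.1 q.1) (mdist p.2 q.2).

Let dist_ge0 p q : 0 <= dist p q.
Proof. by rewrite /dist le_max mdist_ge0. Qed.

Let dist_positivity p q : dist p q = 0 -> p = q.
Proof.
move=> d0; have : dist p q <= 0 by rewrite d0.
rewrite /dist ge_max => /andP[le1 le2].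
case: p q {d0} le1 le2 => [a b] [c d] /= le1 le2; congr pair;
  by apply: mdist_positivity; apply/eqP; rewrite eq_le mdist_ge0 andbT.
Qed.

Let ballEdist p d : ball p d = [set q | dist p q < d].
Proof.
apply/seteqP; split => q /=; rewrite /dist gt_max.
  by case; rewrite !ballEmdist /= => -> ->.
by move=> /andP[h1 h2]; split; rewrite ballEmdist.
Qed.

HB.instance Definition _ :=
  @PseudoMetric_isMetric.Build R (X * Y)%type
    dist dist_ge0 dist_positivity ballEdist.

End prod_metric.

Lemma prod_mdistE (R : realType) (X Y : metricType R) (p q : X * Y) :
  mdist p q = Num.max (mdist p.1 q.1) (mdist p.2 q.2).
Proof. by []. Qed.

Definition bounded_metric (R : realType) (X : metricType R) : Prop :=
  exists D : R, forall x y : X, mdist x y <= D.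

Definition isometric (R : realType) (A B : metricType R) : Prop :=
  exists f : A -> B,
    bijective f /\ forall x y : A, mdist (f x) (f y) = mdist x y.

Definition GHC (A B : Type) : set (set (A * B)) :=
  [set C | (forall a, exists b, C (a, b)) /\ (forall b, exists a, C (a, b))].
Arguments GHC : clear implicits.

(* The distortion and the Gromov-Hausdorff distance are taken in \bar R since
   they may be infinite when the spaces are unbounded. *)
Definition distortion (R : realType) (A B : metricType R) (C : set (A * B)) :
    \bar R :=
  ereal_sup [set (`|mdist p.1 q.1 - mdist p.2 q.2|)%:E | p in C & q in C].

Definition dGH (R : realType) (A B : metricType R) : \bar R :=
  ((2^-1)%:E * ereal_inf [set distortion C | C in GHC A B])%E.

Definition nonempty_compact (R : realType) (K : metricType R) : Prop :=
  [set: K] !=set0 /\ compact [set: K].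

(* [M], with the distance [dGH], is a Gromov-Hausdorff space. It is a
   predicate rather than a [set] because [metricType R] lives in a larger
   universe than the argument of [set]. *)
Definition GH_space (R : realType) (M : metricType R -> Prop) : Prop :=
  [/\ forall K, M K -> nonempty_compact K,
      forall K, nonempty_compact K -> exists2 L, M L & isometric K L
    & forall K L, M K -> M L -> isometric K L -> K = L].

Definition embeds_in_GH (R : realType) (M : metricType R -> Prop)
    (X : metricType R) : Prop :=
  exists f : X -> metricType R,
    (forall x, M (f x)) /\
    (forall x y, dGH (f x) (f y) = (mdist x y)%:E).

Lemma isometric_refl (R : realType) (A : metricType R) : isometric A A.
Proof. by exists id; split=> //; exists id. Qed.

Lemma isometric_sym (R : realType) (A B : metricType R) :
  isometric A B -> isometric B A.
Proof.
move=> [f [[g fK gK] fd]]; exists g; split; first by exists f.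
by move=> x y; rewrite -fd !gK.
Qed.

Lemma isometric_trans (R : realType) (A B C : metricType R) :
  isometric A B -> isometric B C -> isometric A C.
Proof.
move=> [f [bf fd]] [g [bg gd]]; exists (g \o f); split; first exact: bij_comp.
by move=> x y; rewrite /= gd fd.
Qed.

Lemma isometric_nonempty_compact (R : realType) (A B : metricType R) :
  isometric A B -> nonempty_compact A -> nonempty_compact B.
Proof.
move=> [f [[g fK gK] fd]] [[a _] cA]; split; first by exists (f a).
have -> : [set: B] = f @` [set: A].
  by apply/seteqP; split=> // b _; exists (g b).
apply: continuous_compact => //; apply: continuous_subspaceT => x.
apply/(@metricType_numDomainType.cvgrPdist_lt R B) => e e0.
by apply/metricType_numDomainType.nbhs_mdistP; exists e => // y /=; rewrite fd.
Qed.

Lemma GH_space_exists (R : realType) :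
  exists M : metricType R -> Prop, GH_space M.
Proof.
pose cls (K : metricType R) : metricType R -> Prop := isometric K.
have [rep repP] : exists rep : (metricType R -> Prop) -> metricType R,
    forall K, cls K (rep (cls K)).
  exists (fun C => if pselect (exists L, C L) is left h then sval (cid h)
                   else (R^o : metricType R)) => K.
  case: pselect => [h|]; first exact: svalP (cid h).
  by case; exists K; exact: isometric_refl.
have clsE K L : isometric K L -> cls K = cls L.
  move=> KL; apply: functional_extensionality_dep => N.
  apply: propositional_extensionality; split; last exact: isometric_trans.
  by apply: isometric_trans; exact: isometric_sym.
exists (fun K => nonempty_compact K /\ rep (cls K) = K); split.
- by move=> K [].
- move=> K cK; have KL := repP K; exists (rep (cls K)) => //; split.
    exact: isometric_nonempty_compact cK.
  by rewrite -(clsE _ _ KL).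
- by move=> K L [_ <-] [_ <-] KL; rewrite (clsE _ _ (isometric_trans (repP K)
    (isometric_trans KL (isometric_sym (repP L))))).
Qed.

(* Main.v *)
Require Import Defs.
From mathcomp Require Import all_boot all_order all_algebra.
From mathcomp Require Import boolp classical_sets reals ereal topology.
From HB Require Import structures.
From mathcomp Require Import lra.

(**
  If [A x] and [B y] are the compact spaces representing [x] and [y], send
  [(x, y)] to the disjoint union of [A x], [B y] and one extra point [p], with
  distance 2N between [A x] and [B y], 3N between [A x] and [p], and 4N between
  [B y] and [p]. Since [X] and [Y] are bounded, N can be chosen larger than all
  the diameters of the pieces and than all the relevant distortions. A
  correspondence of distortion less than N then respects the three pieces, so
  the Gromov-Hausdorff distance of two such unions is the maximum of the
  distances of the pieces.
*)

Set Implicit Arguments.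
Unset Strict Implicit.
Unset Printing Implicit Defensive.

Import Order.TTheory GRing.Theory Num.Theory.

Local Open Scope classical_set_scope.
Local Open Scope ring_scope.

(** * Real bounds on distortion and diameter *)

Definition dis_le (R : realType) (A B : metricType R) (C : set (A * B))
    (d : R) : Prop :=
  forall a a' b b', C (a, b) -> C (a', b') -> `|mdist a a' - mdist b b'| <= d.

Definition diam_le (R : realType) (A : metricType R) (N : R) : Prop :=
  forall a a' : A, mdist a a' <= N.

Lemma mdist_isometry_continuous (R : realType) (A B : metricType R)
    (f : A -> B) :
  (forall a a', mdist (f a) (f a') = mdist a a') -> continuous f.
Proof.
move=> fd x; apply/(@metricType_numDomainType.cvgrPdist_lt R B) => e e0.
by apply/metricType_numDomainType.nbhs_mdistP; exists e => // y /=; rewrite fd.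
Qed.

(** Locally, distances from a fixed point [a] are bounded by some natural number; compactness makes
    one such bound serve all points. *)
Lemma compact_diam_le (R : realType) (K : metricType R) :
  compact [set: K] -> exists N, @diam_le R K N.
Proof.
move=> cK; case: (pselect (exists a : K, True)) => [[a _]|K0]; last first.
  by exists 0 => x; case: K0; exists x.
have /compact_near_coveringP cov := cK.
have [|N] := cov nat \oo (fun n x => mdist a x <= n%:R) _.
  move=> x _; near_simpl.
  exists ([set y | mdist x y < 1], [set n | mdist a x + 1 <= n%:R]) => /=.
    split.
      by rewrite -metricType_numDomainType.nbhs_nbhs_mdist; exists 1 => /=.
    exists (Num.bound (mdist a x + 1)) => // n /= Nn.
    rewrite (le_trans (ltW (archi_boundP _))) ?ler_nat//.
    by rewrite addr_ge0 ?mdist_ge0.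
  move=> [y n] /= [xy le_n]; have := metric_triangle a x y; lra.
move=> _ /(_ N (leqnn N)) /= H; exists (N%:R + N%:R) => x y.
rewrite (le_trans (metric_triangle x a y))// lerD ?H//.
by rewrite metric_sym H.
Qed.

(** * Gromov-Hausdorff distance via real bounds, and its invariance under isometry *)

Section dGH_real.
Context {R : realType}.
Implicit Types A B : metricType R.

Lemma distortion_le A B (C : set (A * B)) (d : R) :
  (distortion C <= d%:E)%E <-> dis_le C d.
Proof.
split=> [Cd a a' b b' Cab Cab'|Cd].
  rewrite -lee_fin (le_trans _ Cd)//; apply: ereal_sup_ubound.
  by exists (a, b) => //; exists (a', b').
apply: ge_ereal_sup => _ [[a b] Cab [[a' b'] Cab' <-]].
by rewrite lee_fin; apply: Cd.
Qed.

Lemma dGH_le A B (C : set (A * B)) (s : R) :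
  GHC A B C -> dis_le C (2 * s) -> (dGH A B <= s%:E)%E.
Proof.
move=> HC /distortion_le Cs; rewrite /dGH.
have -> : s%:E = ((2^-1)%:E * (2 * s)%:E)%E.
  by rewrite -EFinM mulrA mulVf ?mul1r ?pnatr_eq0.
apply: lee_wpmul2l; first by rewrite lee_fin invr_ge0.
by apply: le_trans Cs; apply: ereal_inf_lbound; exists C.
Qed.

(** If every correspondence had distortion above [2 * s], half the infimum would be at least [s]. *)
Lemma dGH_lt A B (s : R) : (dGH A B < s%:E)%E ->
  exists2 C, GHC A B C & dis_le C (2 * s).
Proof.
move=> Hs; apply: contrapT => noC; move: Hs; apply/negP; rewrite -leNgt.
have -> : s%:E = ((2^-1)%:E * (2 * s)%:E)%E.
  by rewrite -EFinM mulrA mulVf ?mul1r ?pnatr_eq0.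
apply: lee_wpmul2l; first by rewrite lee_fin invr_ge0.
apply: le_ereal_inf_tmp => _ [C HC <-].
case: (leP (2 * s)%:E (distortion C)) => // /ltW /distortion_le Cs.
by case: noC; exists C.
Qed.

(** A correspondence pulled back along the isometry compares the same distances. *)
Lemma dGH_isometric A A' B : isometric A A' -> (dGH A B <= dGH A' B)%E.
Proof.
move=> [f [[g fK gK] fd]].
apply: lee_wpmul2l; first by rewrite lee_fin invr_ge0.
apply: le_ereal_inf_tmp => _ [C [Cl Cr] <-].
apply: ereal_inf_le.
exists (distortion [set p : A * B | C (f p.1, p.2)]).
  exists [set p : A * B | C (f p.1, p.2)] => //; split=> [a|b] /=.
    by have [b Cb] := Cl (f a); exists b.
  by have [a Ca] := Cr b; exists (g a); rewrite gK.
apply: ge_ereal_sup => _ [[a b] Cab [[a' b'] Cab' <-]].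
apply: ereal_sup_ubound; exists (f a, b) => //; exists (f a', b') => //=.
by rewrite fd.
Qed.

Definition swap_rel (S T : Type) (C : set (S * T)) : set (T * S) :=
  [set p | C (p.2, p.1)].

Lemma GHC_swap A B (C : set (A * B)) : GHC A B C -> GHC B A (swap_rel C).
Proof. by case. Qed.

Lemma dis_le_swap A B (C : set (A * B)) d :
  dis_le C d -> dis_le (swap_rel C) d.
Proof. by move=> Cd a a' b b' h h'; rewrite distrC; apply: Cd. Qed.

Lemma dGH_sym_le A B : (dGH A B <= dGH B A)%E.
Proof.
apply: lee_wpmul2l; first by rewrite lee_fin invr_ge0.
apply: le_ereal_inf_tmp => _ [C HC <-].
apply: ereal_inf_le; exists (distortion (swap_rel C)).
  by exists (swap_rel C) => //; exact: GHC_swap.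
apply: ge_ereal_sup => _ [[a b] Cab [[a' b'] Cab' <-]].
by apply: ereal_sup_ubound; exists (b, a) => //; exists (b', a') => //=;
  rewrite distrC.
Qed.

Lemma dGH_sym A B : dGH A B = dGH B A.
Proof. by apply/eqP; rewrite eq_le !dGH_sym_le. Qed.

Lemma dGH_isometric2 A A' B B' :
  isometric A A' -> isometric B B' -> dGH A B = dGH A' B'.
Proof.
have E (K K' L : metricType R) : isometric K K' -> dGH K L = dGH K' L.
  move=> KK'; apply/eqP; rewrite eq_le; apply/andP.
  by split; apply: dGH_isometric; last exact: isometric_sym.
by move=> AA' BB'; rewrite (E _ _ _ AA') dGH_sym (E _ _ _ BB') dGH_sym.
Qed.

End dGH_real.

(** * The glued space: metric and compactness *)

Section glue.
Context {R : realType} (N : R) (A B : metricType R).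

(* [None] is the extra point; the bounds are arguments of the type because the
   triangle inequality depends on them. *)
Definition glue of 0 < N & diam_le A N & diam_le B N : Type := option (A + B).

Hypotheses (N0 : 0 < N) (hA : diam_le A N) (hB : diam_le B N).
Local Notation T := (glue N0 hA hB).

HB.instance Definition _ := Choice.copy T (option (A + B)).

Definition glue_dist (p q : T) : R :=
  match p, q with
  | None, None => 0
  | Some (inl a), Some (inl a') => mdist a a'
  | Some (inr b), Some (inr b') => mdist b b'
  | Some (inl _), Some (inr _) | Some (inr _), Some (inl _) => 2 * N
  | Some (inl _), None | None, Some (inl _) => 3 * N
  | Some (inr _), None | None, Some (inr _) => 4 * N
  end.

Let glue_dist_xx p : glue_dist p p = 0.
Proof. by case: p => [[a|b]|] //=; rewrite mdistxx. Qed.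

Let glue_dist_positivity p q : glue_dist p q = 0 -> p = q.
Proof.
move: p q => [[a|b]|] [[a'|b']|] //=; try by move/mdist_positivity->.
all: by move=> d0; exfalso; have := N0; lra.
Qed.

Let glue_dist_sym p q : glue_dist p q = glue_dist q p.
Proof. by move: p q => [[a|b]|] [[a'|b']|] //=; rewrite metric_sym. Qed.

(** Any two of 2N, 3N, 4N sum to at least the third, and a distance inside a piece is at most N,
    less than twice any of them. *)
Let glue_dist_triangle q p r :
  glue_dist p r <= glue_dist p q + glue_dist q r.
Proof.
have n0 := N0.
have gA (a a' : A) : 0 <= mdist a a' by exact: mdist_ge0.
have gB (b b' : B) : 0 <= mdist b b' by exact: mdist_ge0.
move: p q r => [[p|p]|] [[q|q]|] [[r|r]|] //=; try exact: metric_triangle;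
  by try (have := hA p r); try (have := hB p r); try (have := gA p q);
     try (have := gA q r); try (have := gB p q); try (have := gB q r); lra.
Qed.

HB.instance Definition _ := @isMetric.Build R T
  glue_dist glue_dist_xx glue_dist_positivity glue_dist_sym glue_dist_triangle.

Lemma glue_mdistE (p q : T) : mdist p q = glue_dist p q.
Proof. by []. Qed.

Lemma glue_compact : nonempty_compact A -> nonempty_compact B ->
  nonempty_compact T.
Proof.
move=> [_ cA] [_ cB]; split; first by exists None.
pose iA (a : A) : T := Some (inl a).
pose iB (b : B) : T := Some (inr b).
have -> : [set: T] = [set None] `|` (iA @` [set: A] `|` iB @` [set: B]).
  apply/seteqP; split=> // -[[a|b]|] _; last by left.
    by right; left; exists a.
  by right; right; exists b.
apply: compactU; first exact: compact_set1.
by apply: compactU; apply: continuous_compact => //;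
  apply: continuous_subspaceT; apply: mdist_isometry_continuous.
Qed.

End glue.

(** * Gromov-Hausdorff distance between glued spaces *)

Section glue_dGH.
Context {R : realType} (N : R) (N0 : 0 < N).

(** Distances in a glued space lie in [0, N] or equal 2N, 3N or 4N. These classes are at least N
    apart, so a distortion below N cannot mix them. *)
Lemma glue_rel_pieces (A A' B B' : metricType R)
    (hA : diam_le A N) (hA' : diam_le A' N)
    (hB : diam_le B N) (hB' : diam_le B' N)
    (C : set (glue N0 hA hB * glue N0 hA' hB')) (d : R) :
  [set: A'] !=set0 -> [set: B'] !=set0 ->
  GHC _ _ C -> d < N -> dis_le C d ->
  (forall a, exists a', C (Some (inl a), Some (inl a'))) /\
  (forall b, exists b', C (Some (inr b), Some (inr b'))).
Proof.
move=> [a0 _] [b0 _] [Cl Cr] dN Cd; have n0 := N0.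
(* The points of [A] are those with no point at distance 4N, and the points of
   [B] those with a point at distance 4N but none at distance 3N. *)
split=> [a|b].
- have [[[a'|b']|] Ca] := Cl (Some (inl a)); first by exists a'.
  + have [p Cp] := Cr None.
    have := Cd _ _ _ _ Ca Cp; rewrite !glue_mdistE ler_norml.
    by case: p Cp => [[p|p]|] _ /=; first have := hA a p; lra.
  + have [p Cp] := Cr (Some (inr b0)).
    have := Cd _ _ _ _ Ca Cp; rewrite !glue_mdistE ler_norml.
    by case: p Cp => [[p|p]|] _ /=; first have := hA a p; lra.
- have [[[a'|b']|] Cb] := Cl (Some (inr b)); last 2 first.
  + by exists b'.
  + have [p Cp] := Cr (Some (inl a0)).
    have := Cd _ _ _ _ Cb Cp; rewrite !glue_mdistE ler_norml.
    by case: p Cp => [[p|p]|] _ /=; try (have := hB b p); lra.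
  + have [p Cp] := Cl None.
    have := Cd _ _ _ _ Cb Cp; rewrite !glue_mdistE ler_norml.
    by case: p Cp => [[p|p]|] _ /=; try (have := hA' a' p); lra.
Qed.

Lemma dGH_glue (A A' B B' : metricType R)
    (hA : diam_le A N) (hA' : diam_le A' N)
    (hB : diam_le B N) (hB' : diam_le B' N) (r s : R) :
  [set: A] !=set0 -> [set: A'] !=set0 ->
  [set: B] !=set0 -> [set: B'] !=set0 ->
  dGH A A' = r%:E -> dGH B B' = s%:E -> 2 * r < N -> 2 * s < N ->
  dGH (glue N0 hA hB) (glue N0 hA' hB') = (Num.max r s)%:E.
Proof.
move=> nA nA' nB nB' dA dB rN sN; apply/eqP; rewrite eq_le; apply/andP; split.
  apply/lee_addgt0Pr => e e0; rewrite -EFinD.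
  have [|CA [CAl CAr] CAd] := @dGH_lt R A A' (Num.max r s + e).
    by rewrite dA lte_fin ltr_pwDr// le_max lexx.
  have [|CB [CBl CBr] CBd] := @dGH_lt R B B' (Num.max r s + e).
    by rewrite dB lte_fin ltr_pwDr// le_max lexx orbT.
  (* The union of the two correspondences with the extra points matched: distances across pieces
     agree exactly and add no distortion. *)
  pose C : set (glue N0 hA hB * glue N0 hA' hB') := [set p |
    match p with
    | (None, None) => True
    | (Some (inl a), Some (inl a')) => CA (a, a')
    | (Some (inr b), Some (inr b')) => CB (b, b')
    | _ => False
    end].
  apply: (@dGH_le _ _ _ C).
    split=> [[[a|b]|]|[[a'|b']|]].
    - by have [a' ?] := CAl a; exists (Some (inl a')).
    - by have [b' ?] := CBl b; exists (Some (inr b')).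
    - by exists None.
    - by have [a ?] := CAr a'; exists (Some (inl a)).
    - by have [b ?] := CBr b'; exists (Some (inr b)).
    - by exists None.
  have m0 : 0 <= 2 * (Num.max r s + e).
    have [a _] := nA; have [a' Ca] := CAl a.
    exact: le_trans (normr_ge0 _) (CAd _ _ _ _ Ca Ca).
  move=> [[p|p]|] [[q|q]|] [[p'|p']|] [[q'|q']|] //= Cp Cq;
    first [exact: CAd | exact: CBd | by rewrite glue_mdistE/= subrr normr0].
apply/lee_addgt0Pr => e e0; rewrite leNgt; apply/negP => lt_m.
have {lt_m} : (dGH (glue N0 hA hB) (glue N0 hA' hB')
    < (Num.max r s - e)%:E)%E.
  by rewrite EFinB lteBrDr.
move=> /dGH_lt[C HC Cd].
(* A correspondence this tight respects the pieces, so its restrictions would bound both [r] and [s]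
   by [Num.max r s - e], which is absurd. *)
have dN : 2 * (Num.max r s - e) < N.
  by case: (leP r s) => _; lra.
have [CAl CBl] := glue_rel_pieces nA' nB' HC dN Cd.
(* Swapping the factors shows that the restrictions also cover [A'] and [B']. *)
have [CAr CBr] := glue_rel_pieces nA nB (GHC_swap HC) dN (dis_le_swap Cd).
have rm : r <= Num.max r s - e.
  rewrite -lee_fin -dA.
  apply: (@dGH_le _ _ _ [set p | C (Some (inl p.1), Some (inl p.2))]) => //.
  by move=> a b a' b' Ca Cb; exact: (Cd _ _ _ _ Ca Cb).
have sm : s <= Num.max r s - e.
  rewrite -lee_fin -dB.
  apply: (@dGH_le _ _ _ [set p | C (Some (inr p.1), Some (inr p.2))]) => //.
  by move=> a b a' b' Ca Cb; exact: (Cd _ _ _ _ Ca Cb).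
by move: rm sm; case: (leP r s) => _; lra.
Qed.

End glue_dGH.

(** * Uniform diameter bounds and the embedding of the product *)

Lemma bounded_family_diam_le (R : realType) (X : metricType R)
    (f : X -> metricType R) :
  bounded_metric X -> (forall x, compact [set: f x]) ->
  (forall x y, dGH (f x) (f y) = (mdist x y)%:E) ->
  exists N, forall x, diam_le (f x) N.
Proof.
move=> [D hD] cf fd.
case: (pselect (exists x : X, True)) => [[x0 _]|X0]; last first.
  by exists 0 => x; case: X0; exists x.
have [L hL] := compact_diam_le (cf x0).
(* A correspondence with [f x0] changes distances by at most [2 * (D + 1)]; the added 1 provides the
   strict inequality that [dGH_lt] asks for. *)
exists (L + 2 * (D + 1)) => x a a'.
have [|C [Cl _] Cd] := @dGH_lt R (f x) (f x0) (D + 1).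
  by rewrite fd lte_fin (le_lt_trans (hD _ _))// ltrDl.
have [b Cb] := Cl a; have [b' Cb'] := Cl a'.
have := Cd _ _ _ _ Cb Cb'; rewrite ler_norml => /andP[_].
by have := hL b b'; lra.
Qed.

Theorem corollary1p5 (R : realType) (M : metricType R -> Prop)
    (hM : GH_space M) (X Y : metricType R)
    (bX : bounded_metric X) (bY : bounded_metric Y)
    (eX : embeds_in_GH M X) (eY : embeds_in_GH M Y) :
  embeds_in_GH M (X * Y)%type.
Proof.
have [Mc Mrep _] := hM.
have [f [Mf fd]] := eX; have [g [Mg gd]] := eY.
have cf x := Mc _ (Mf x); have cg y := Mc _ (Mg y).
have [LX hLX] := bounded_family_diam_le bX (fun x => (cf x).2) fd.
have [LY hLY] := bounded_family_diam_le bY (fun y => (cg y).2) gd.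
have [DX hDX] := bX; have [DY hDY] := bY.
(* Absolute values guard against negative bounds, possible when a factor is empty; the final 1 makes
   [N] positive and the bounds on [2 * r] and [2 * s] strict. *)
pose N : R := `|LX| + `|LY| + 2 * `|DX| + 2 * `|DY| + 1.
have [lX lY] := (ler_norm LX, ler_norm LY).
have [dX dY] := (ler_norm DX, ler_norm DY).
have [l0X l0Y] := (normr_ge0 LX, normr_ge0 LY).
have [d0X d0Y] := (normr_ge0 DX, normr_ge0 DY).
have N0 : 0 < N by rewrite /N; lra.
have hf x : diam_le (f x) N.
  by move=> a a'; have := hLX x a a'; rewrite /N; lra.
have hg y : diam_le (g y) N.
  by move=> b b'; have := hLY y b b'; rewrite /N; lra.
(* The glued space itself need not satisfy [M], so an isometric representative replaces it. *)
have rep (p : X * Y) :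
    exists2 L, M L & isometric (glue N0 (hf p.1) (hg p.2)) L.
  by apply: Mrep; apply: glue_compact.
exists (fun p => s2val (cid2 (rep p))); split=> [p|p q].
  exact: (s2valP (cid2 (rep p))).
rewrite -(dGH_isometric2 (s2valP' (cid2 (rep p))) (s2valP' (cid2 (rep q)))).
rewrite prod_mdistE; apply: dGH_glue; rewrite ?fd ?gd//.
- exact: (cf _).1.
- exact: (cf _).1.
- exact: (cg _).1.
- exact: (cg _).1.
- by have := hDX p.1 q.1; rewrite /N; lra.
- by have := hDY p.2 q.2; rewrite /N; lra.
Qed.
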